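(* Let $p$ be a prime, let $V$ be a vector space over $\mathbb{Q}_p$ of finite dimension $n$, let $N$ be a norm on $V$, and let $\mathcal{L}$ be a full-rank $p$-adic lattice in $V$ (i.e. of rank $n$). Then $\mu(\mathcal{L})=p\,\tilde{\lambda}_n(\mathcal{L})$.
   Context: A norm on a $\mathbb{Q}_p$-vector space $V$ is a function $N:V\to\mathbb{R}$ with $N(v)\ge0$, $N(v)=0$ iff $v=0$; $N(xv)=|x|_p N(v)$ for $x\in\mathbb{Q}_p$; and $N(v+w)\le\max\{N(v),N(w)\}$. For $\mathbb{Q}_p$-linearly independent $\alpha_1,\dots,\alpha_m\in V$, the $p$-adic lattice $\mathcal{L}(\alpha_1,\dots,\alpha_m)=\{\sum_{i=1}^m a_i\alpha_i: a_i\in\mathbb{Z}_p\}$ has rank $m$. A basis $\beta_1,\dots,\beta_m$ of a lattice is an $N$-orthogonal basis of it if $N(\sum_i x_i\beta_i)=\max_i N(x_i\beta_i)$ for all $x_i\in\mathbb{Q}_p$. Every $p$-adic lattice of rank $n$ has an $N$-orthogonal basis, and for any $N$-orthogonal basis $\beta_1,\dots,\beta_n$ of $\mathcal{L}$ ordered so that $N(\beta_1)\ge\cdots\ge N(\beta_n)$, the values $N(\beta_i)$ do not depend on the choice; the $i$-th successive maximum is $\tilde{\lambda}_i(\mathcal{L}):=N(\beta_i)$. For $x\in V$, $\mathrm{dist}(x,\mathcal{L})=\min_{v\in\mathcal{L}}N(x-v)$, and the escape distance of a full-rank lattice is $\mu(\mathcal{L}):=\min_{x\in V\setminus\mathcal{L}}\mathrm{dist}(x,\mathcal{L})$.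 *)

(* Defs.v *)
From HB Require Import structures.
From mathcomp Require Import all_boot all_order all_algebra.
From mathcomp Require Import fraction.
From mathcomp Require Import boolp classical_sets reals.

Set Implicit Arguments.
Unset Strict Implicit.
Unset Printing Implicit Defensive.

Import Order.TTheory GRing.Theory Num.Theory.

Local Open Scope ring_scope.

(* Z_p is the inverse limit of the rings Z/p^n: a p-adic integer is the        *)
(* sequence of its residues modulo p^n, each represented in {0, ..., p^n - 1}  *)
(* (the bound is forced by the compatibility condition).                       *)
Record padic_int (p : nat) (p_pr : prime p) := PadicInt {
  residue :> nat -> nat;
  residueP : forall n, (residue n.+1 %% p ^ n)%N = residue n }.

Section PadicInt.
Context (p : nat) (p_pr : prime p).
Local Notation Zp := (padic_int p_pr).
Implicit Types x y z : Zp.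

HB.instance Definition _ := gen_eqMixin Zp.
HB.instance Definition _ := gen_choiceMixin Zp.

Lemma padic_int_ext x y : (forall n, x n = y n) -> x = y.
Proof.
case: x y => [x xP] [y yP] /= /funext exy.
by case: y / exy yP => yP; congr PadicInt; apply: Prop_irrelevance.
Qed.

Lemma residue_mod x n : (x n %% p ^ n)%N = x n.
Proof. by rewrite -residueP modn_mod. Qed.

Lemma residue_lt x n : (x n < p ^ n)%N.
Proof. by rewrite -residue_mod ltn_pmod // expn_gt0 prime_gt0. Qed.

Lemma residue_le x m n : (m <= n)%N -> (x n %% p ^ m)%N = x m.
Proof.
elim: n => [|n IHn]; first by rewrite leqn0 => /eqP->; exact: residue_mod.
rewrite leq_eqVlt => /predU1P[->|lemn]; first exact: residue_mod.
rewrite -IHn // -(residueP x n) modn_dvdm //; exact: dvdn_exp2l.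
Qed.

Lemma padic_of_seq_subproof (s : nat -> nat) :
  (forall n, s n.+1 = s n %[mod p ^ n]) ->
  forall n, ((s n.+1 %% p ^ n.+1) %% p ^ n)%N = (s n %% p ^ n)%N.
Proof. by move=> sP n; rewrite modn_dvdm ?dvdn_exp2l. Qed.

Definition padic_of_seq s (sP : forall n, s n.+1 = s n %[mod p ^ n]) : Zp :=
  PadicInt p_pr (padic_of_seq_subproof sP).

Lemma padic_add_subproof x y n :
  (x n.+1 + y n.+1 = x n + y n %[mod p ^ n])%N.
Proof. by rewrite -modnDm !residueP. Qed.

Lemma padic_mul_subproof x y n :
  (x n.+1 * y n.+1 = x n * y n %[mod p ^ n])%N.
Proof. by rewrite -modnMm !residueP. Qed.

Lemma padic_opp_subproof x n :
  (p ^ n.+1 - x n.+1 = p ^ n - x n %[mod p ^ n])%N.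
Proof.
apply/eqP; rewrite -(eqn_modDr (x n.+1)) subnK ?(ltnW (residue_lt _ _)) //.
rewrite -(modnDmr _ (x n.+1)) residueP subnK ?(ltnW (residue_lt _ _)) //.
by rewrite modnn expnS modnMl.
Qed.

Definition padic_nat (k : nat) : Zp :=
  padic_of_seq (s := fun=> k) (fun=> erefl).
Definition padic_add x y : Zp := padic_of_seq (padic_add_subproof x y).
Definition padic_mul x y : Zp := padic_of_seq (padic_mul_subproof x y).
Definition padic_opp x : Zp := padic_of_seq (padic_opp_subproof x).

Lemma padic_addA : associative padic_add.
Proof.
by move=> x y z; apply: padic_int_ext => n /=; rewrite modnDml modnDmr addnA.
Qed.

Lemma padic_addC : commutative padic_add.
Proof. by move=> x y; apply: padic_int_ext => n /=; rewrite addnC. Qed.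

Lemma padic_add0 : left_id (padic_nat 0) padic_add.
Proof.
by move=> x; apply: padic_int_ext => n /=; rewrite modnDml add0n residue_mod.
Qed.

Lemma padic_addN : left_inverse (padic_nat 0) padic_opp padic_add.
Proof.
move=> x; apply: padic_int_ext => n /=.
by rewrite modnDml subnK ?(ltnW (residue_lt _ _)) // modnn mod0n.
Qed.

HB.instance Definition _ :=
  GRing.isZmodule.Build Zp padic_addA padic_addC padic_add0 padic_addN.

Lemma padic_mulA : associative padic_mul.
Proof.
by move=> x y z; apply: padic_int_ext => n /=; rewrite modnMml modnMmr mulnA.
Qed.

Lemma padic_mulC : commutative padic_mul.
Proof. by move=> x y; apply: padic_int_ext => n /=; rewrite mulnC. Qed.

Lemma padic_mul1 : left_id (padic_nat 1) padic_mul.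
Proof.
by move=> x; apply: padic_int_ext => n /=; rewrite modnMml mul1n residue_mod.
Qed.

Lemma padic_mulDl : left_distributive padic_mul +%R.
Proof.
move=> x y z; apply: padic_int_ext => n /=.
by rewrite modnMml modnDm mulnDl.
Qed.

Lemma padic_oner_neq0 : padic_nat 1 != 0.
Proof.
apply/eqP => /(congr1 (fun x : Zp => x 1%N)) /=.
by rewrite expn1 mod0n modn_small ?prime_gt1.
Qed.

HB.instance Definition _ := GRing.Zmodule_isComNzRing.Build Zp
  padic_mulA padic_mulC padic_mul1 padic_mulDl padic_oner_neq0.

Definition padic_unit : {pred Zp} := fun x => `[< exists y, y * x = 1 >].
Definition padic_inv x : Zp := xget x [set y | y * x = 1].

Lemma padic_mulV : {in padic_unit, left_inverse 1 padic_inv *%R}.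
Proof.
by move=> x /asboolP[y yx1]; rewrite /padic_inv; case: xgetP => [//|/(_ y)].
Qed.

Lemma padic_unitPl x y : y * x = 1 -> padic_unit x.
Proof. by move=> yx1; apply/asboolP; exists y. Qed.

Lemma padic_inv_out : {in [predC padic_unit], padic_inv =1 id}.
Proof.
move=> x /negP nUx; rewrite /padic_inv; case: xgetP => [y _ /= yx1|//].
by case: nUx; exact: padic_unitPl yx1.
Qed.

HB.instance Definition _ := GRing.ComNzRing_hasMulInverse.Build Zp
  padic_mulV padic_unitPl padic_inv_out.

(* p^k divides x but p^(k+1) does not; the default value 0 is only used for    *)
(* x = 0.                                                                      *)
Definition padic_val x : nat := xget 0%N [set k | x k = 0%N /\ x k.+1 <> 0%N].

Lemma residue0 n : (0 : Zp) n = 0%N. Proof. exact: mod0n. Qed.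

Lemma padic_neq0 x : x != 0 -> exists n, x n != 0%N.
Proof.
move=> x0; apply: contrapT => h; move/eqP: x0; apply.
apply: padic_int_ext => n; rewrite residue0; apply/eqP.
by apply: contrapT => /negP xn0; apply: h; exists n.
Qed.

Lemma padic_valP x : x != 0 ->
  x (padic_val x) = 0%N /\ x (padic_val x).+1 <> 0%N.
Proof.
move=> /padic_neq0 ex; rewrite /padic_val; case: xgetP => [k -> //|none].
case: (ex_minnP ex) => -[|m] xm min_m.
  by move: xm; rewrite -residue_mod modn1.
case: (none m); split; last exact/eqP.
by apply/eqP/negPn/negP => /min_m; rewrite ltnn.
Qed.

Lemma padic_val_unique x k : x k = 0%N -> x k.+1 <> 0%N -> padic_val x = k.
Proof.
move=> xk xk1.
have x0 : x != 0 by apply/eqP => x0; apply: xk1; rewrite x0 residue0.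
have zero_le m n : (m <= n)%N -> x n = 0%N -> x m = 0%N.
  by move=> /(residue_le x) <- ->; rewrite mod0n.
have [xv xv1] := padic_valP x0.
case: (ltngtP (padic_val x) k) => // h.
  by case: xv1; exact: zero_le xk.
by case: xk1; exact: zero_le xv.
Qed.

Lemma padic_logn x n : x != 0 -> (padic_val x < n)%N ->
  logn p (x n) = padic_val x /\ (0 < x n)%N.
Proof.
move=> x0 ltvn; have [xv xv1] := padic_valP x0; set k := padic_val x in xv xv1 *.
have xn0 : (0 < x n)%N.
  rewrite lt0n; apply/eqP => xn; apply: xv1.
  by rewrite -(residue_le x ltvn) xn mod0n.
split=> //; apply/eqP; rewrite eqn_leq -pfactor_dvdn //.
rewrite /dvdn residue_le ?xv ?(ltnW ltvn) // eqxx andbT.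
by rewrite leqNgt -pfactor_dvdn // /dvdn residue_le //; apply/eqP.
Qed.

Lemma padic_mul_val x y : x != 0 -> y != 0 ->
  x * y != 0 /\ padic_val (x * y) = (padic_val x + padic_val y)%N.
Proof.
move=> x0 y0; set k := (_ + _)%N.
have [||lx xn] := @padic_logn x k.+1 => //; first by rewrite ltnS leq_addr.
have [||ly yn] := @padic_logn y k.+1 => //; first by rewrite ltnS leq_addl.
have xyk : (x * y) k = 0%N.
  apply/eqP; change ((p ^ k %| x k * y k)%N).
  rewrite /k expnD; apply: dvdn_mul; rewrite /dvdn residue_le ?leq_addr ?leq_addl //.
    by rewrite (proj1 (padic_valP x0)).
  by rewrite (proj1 (padic_valP y0)).
have xyk1 : (x * y) k.+1 <> 0%N.
  apply/eqP; change (~~ (p ^ k.+1 %| x k.+1 * y k.+1)%N).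
  by rewrite pfactor_dvdn ?muln_gt0 ?xn // lognM // lx ly ltnn.
split; last exact: padic_val_unique.
by apply/eqP => e; apply: xyk1; rewrite e residue0.
Qed.

Lemma padic_integral : GRing.integral_domain_axiom Zp.
Proof.
move=> x y /eqP; apply: contraTT; rewrite negb_or => /andP[x0 y0].
by case: (padic_mul_val x0 y0).
Qed.

HB.instance Definition _ := GRing.ComUnitRing_isIntegral.Build Zp padic_integral.

End PadicInt.

Notation padic p_pr := {fraction padic_int p_pr}.
Notation "x %:F" := (@FracField.tofrac _ x) : ring_scope.

Section PadicAbs.
Context (R : realType) (p : nat) (p_pr : prime p).
Local Notation Zp := (padic_int p_pr).
Local Notation Qp := (padic p_pr).

(* |a / b|_p = p ^ (v(b) - v(a)); see padic_abs_frac for the independence of   *)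
(* the chosen numerator and denominator.                                       *)
Definition padic_abs (x : Qp) : R :=
  if x == 0 then 0
  else p%:R ^+ padic_val \d_(repr x) / p%:R ^+ padic_val \n_(repr x).

Lemma padic_abs_frac (a b : Zp) : a != 0 -> b != 0 ->
  padic_abs (a%:F / b%:F) = p%:R ^+ padic_val b / p%:R ^+ padic_val a.
Proof.
move=> a0 b0; have p0 (k : nat) : p%:R ^+ k != 0 :> R.
  by rewrite expf_neq0 // pnatr_eq0 -lt0n prime_gt0.
set x := a%:F / b%:F; have x0 : x != 0 by rewrite mulf_neq0 ?invr_eq0 ?tofrac_eq0.
rewrite /padic_abs (negPf x0).
set n := \n__; set d := \d__.
have d0 : d != 0 by exact: denom_ratioP.
have xE : x = n%:F / d%:F.
  apply: (canRL (mulfK _)); first by rewrite tofrac_eq0.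
  rewrite -{1}[x]reprK; unlock FracField.tofrac; rewrite -[LHS]FracField.pi_mul.
  apply/eqmodP; rewrite /= FracField.equivfE /FracField.mulf.
  by rewrite !numden_Ratio ?mulf_neq0 ?oner_neq0 // !mulr1 mulrC.
have n0 : n != 0.
  by apply: contraNneq x0 => n0; rewrite xE n0 tofrac0 mul0r.
have /eqP : a * d = n * b.
  apply/eqP; rewrite -tofrac_eq !tofracM; apply/eqP.
  have := xE; rewrite /x => /eqP; rewrite eqr_div ?tofrac_eq0 //; exact/eqP.
move=> /eqP /(congr1 (@padic_val _ _)).
rewrite (proj2 (padic_mul_val a0 d0)) (proj2 (padic_mul_val n0 b0)) => e.
by apply/eqP; rewrite eqr_div // -!exprD addnC e addnC.
Qed.

End PadicAbs.

Section Lattice.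
Context (R : realType) (p : nat) (p_pr : prime p) (V : vectType (padic p_pr)).
Local Notation Zp := (padic_int p_pr).
Local Notation Qp := (padic p_pr).
Local Open Scope classical_set_scope.

Record is_padic_norm (N : V -> R) : Prop := {
  padic_norm_ge0 : forall v, 0 <= N v;
  padic_norm_eq0 : forall v, N v = 0 <-> v = 0;
  padic_normZ : forall (x : Qp) v, N (x *: v) = padic_abs R x * N v;
  padic_normD : forall v w, N (v + w) <= Num.max (N v) (N w) }.

Definition lattice_span m (alpha : m.-tuple V) : set V :=
  [set v | exists a : 'I_m -> Zp, v = \sum_i (a i)%:F *: alpha`_i].

Definition lattice_basis m (L : set V) (alpha : m.-tuple V) : Prop :=
  free alpha /\ L = lattice_span alpha.

Definition is_lattice (m : nat) (L : set V) : Prop :=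
  exists alpha : m.-tuple V, lattice_basis L alpha.

(* The norm being nonnegative, 0 is a neutral initial value for the maximum.   *)
Definition orthogonal_basis (N : V -> R) m (L : set V) (beta : m.-tuple V) :=
  lattice_basis L beta /\
  forall x : 'I_m -> Qp,
    N (\sum_i x i *: beta`_i) = \big[Num.max/0]_i N (x i *: beta`_i).

Definition nonincreasing_norm (N : V -> R) m (beta : m.-tuple V) : Prop :=
  forall i j : 'I_m, (i <= j)%N -> N beta`_j <= N beta`_i.

(* The i-th successive maximum of a lattice of rank m, for 1 <= i <= m; the    *)
(* index is 1-based.                                                           *)
Definition successive_max (N : V -> R) (m : nat) (L : set V) (i : nat) : R :=
  xget 0 [set r | exists beta : m.-tuple V,
    [/\ orthogonal_basis N L beta, nonincreasing_norm N beta
      & r = N beta`_i.-1]].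

(* The minimum of A, which has to be attained; 0 if A has no minimum.          *)
Definition min_of (A : set R) : R := xget 0 [set r | A r /\ lbound A r].

Definition dist (N : V -> R) (L : set V) (x : V) : R :=
  min_of [set N (x - v) | v in L].

Definition escape_distance (N : V -> R) (L : set V) : R :=
  min_of [set dist N L x | x in ~` L].

End Lattice.

(* Main.v *)
(* A lattice basis minimizing the sum of the norms of its vectors is          *)
(* orthogonal: if N (sum x_i b_i) < max N (x_i b_i), a combination of the b_i *)
(* with p-adic integer coefficients could replace some b_j by a shorter       *)
(* vector. Such a basis exists because the norm is bounded below on primitive *)
(* vectors (compactness of Z_p), hence takes finitely many values on them.    *)
(* With respect to an orthogonal basis, x lies outside L iff some coordinate  *)
(* x_i is not a p-adic integer; then |x_i| >= p, so N x >= p N(b_n), and the  *)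
(* bound is attained at b_n / p.                                              *)
Require Import Defs.
From HB Require Import structures.
From mathcomp Require Import all_boot all_order all_algebra.
From mathcomp Require Import fraction fingroup perm cyclic.
From mathcomp Require Import boolp classical_sets reals.

Import Order.TTheory GRing.Theory Num.Theory.

Local Open Scope ring_scope.

(** Let b_1, ..., b_n be an orthogonal basis of L with nonincreasing norms. An element of Q_p
    outside Z_p has absolute value at least p, so a vector outside L, having such a coordinate, has
    norm at least p N(b_n) ([norm_notin_ge]). Translation by L preserves being outside L, so the
    bound passes to distances, and b_n / p attains it ([escape_distance_orthogonal]).

    The harder part is the existence of such a basis ([orthogonal_basis_exists]): an exchange
    argument shows that a basis with minimal sum of norms is orthogonal. The minimum exists
    ([lattice_basis_min]) because basis vectors have primitive coefficients in a fixed basis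
    ([lattice_basis_primitive]), and the norm of a primitive combination depends only on its
    coefficients modulo a fixed p^K ([padic_norm_locally_constant], from [padic_compact]). *)

(** * Divisibility and units in Z_p *)

Section PadicArithmetic.
Context (p : nat) (p_pr : prime p).
Local Notation Zp := (padic_int p_pr).
Local Notation Qp := (padic p_pr).
Implicit Types (x y : Zp) (z : Qp).

Lemma residueD x y n : (x + y) n = ((x n + y n) %% p ^ n)%N.
Proof. by []. Qed.

Lemma residueM x y n : (x * y) n = ((x n * y n) %% p ^ n)%N.
Proof. by []. Qed.

Lemma residue_natr k n : (k%:R : Zp) n = (k %% p ^ n)%N.
Proof.
elim: k => [|k IHk]; first by rewrite mulr0n residue0 mod0n.
by rewrite mulrSr residueD IHk modnDm addn1.
Qed.

Lemma residueB_eq0 x y n : (x - y) n = 0%N <-> x n = y n.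
Proof.
split=> [xy0|xy].
  by rewrite -[x](subrK y) residueD xy0 add0n residue_mod.
have -> : (x - y) n = (y - y) n by rewrite !residueD xy.
by rewrite subrr residue0.
Qed.

Lemma residue_eq0P x k : x k = 0%N <-> exists y, x = p%:R ^+ k * y.
Proof.
have pk_gt0 j : (0 < p ^ j)%N by rewrite expn_gt0 prime_gt0.
split=> [xk0|[y ->]]; last by rewrite residueM -natrX residue_natr modnn mod0n.
(* Dividing by p^k costs k levels of precision, so the quotient at level n is read off [x] at level
   n + k. *)
have sP n : (x (n.+1 + k) %/ p ^ k = x (n + k) %/ p ^ k %[mod p ^ n])%N.
  by rewrite !modn_divl -expnD !(residue_le x) // addSn leqnSn.
exists (padic_of_seq p_pr sP); apply: padic_int_ext => n.
rewrite residueM -natrX residue_natr modnMml /= modn_divl -expnD residue_mod.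
rewrite muln_divA; last by rewrite /dvdn residue_le ?xk0 ?leq_addl.
by rewrite mulKn // residue_le ?leq_addr.
Qed.

Lemma residue_unit x : x 1%N != 0%N -> x \is a GRing.unit.
Proof.
move=> x1; have x_cop n : coprime (x n) (p ^ n).
  case: n => [|n]; first by rewrite coprimen1.
  rewrite coprimeXr // coprime_sym prime_coprime //.
  by rewrite /dvdn -{2}(expn1 p) residue_le.
(* By Euler's theorem this power inverts [x n] modulo p^n; the inverses are compatible because an
   inverse modulo p^n is unique. *)
pose s n := (x n ^ (totient (p ^ n)).-1)%N.
have xs n : (x n * s n = 1 %[mod p ^ n])%N.
  rewrite -expnS prednK ?totient_gt0 ?expn_gt0 ?prime_gt0 //.
  exact: Euler_exp_totient.
have sP n : (s n.+1 = s n %[mod p ^ n])%N.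
  have xs' : (x n * s n.+1 = 1 %[mod p ^ n])%N.
    have /(congr1 (modn^~ (p ^ n)%N)) := xs n.+1.
    rewrite !modn_dvdm ?dvdn_exp2l // => <-.
    by rewrite -modnMml -(residueP x n) modn_mod modnMml.
  rewrite -[in LHS](muln1 (s _)) -modnMmr -(xs n) modnMmr mulnA.
  by rewrite (mulnC (s _)) -modnMml xs' modnMml mul1n.
apply/unitrPr; exists (padic_of_seq p_pr sP); apply: padic_int_ext => n.
by rewrite residueM /= modnMmr xs.
Qed.

Lemma padic_unit_factor x : x != 0 ->
  exists2 u, u \is a GRing.unit & x = p%:R ^+ padic_val x * u.
Proof.
move=> x0; have [xv xv1] := padic_valP x0.
have [y xE] := (residue_eq0P x (padic_val x)).1 xv; exists y => //.
apply: residue_unit; apply/eqP => /(residue_eq0P y 1)[w yE].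
apply: xv1; apply/residue_eq0P; exists w.
by rewrite {1}xE {1}yE expr1 mulrA -exprSr.
Qed.

Lemma padic_fracE z : exists x y, y != 0 /\ z = x%:F / y%:F.
Proof.
exists \n_(generic_quotient.repr z), \d_(generic_quotient.repr z).
split; first exact: denom_ratioP.
have d0 : \d_(generic_quotient.repr z) != 0 by exact: denom_ratioP.
apply: (canRL (mulfK _)); first by rewrite tofrac_eq0.
rewrite -{1}[z]reprK; unlock FracField.tofrac; rewrite -[LHS]FracField.pi_mul.
apply/eqmodP; rewrite /= FracField.equivfE /FracField.mulf.
by rewrite !numden_Ratio ?mulf_neq0 ?oner_neq0 // !mulr1 mulrC.
Qed.

Lemma padic_p_neq0 : p%:R != 0 :> Zp.
Proof.
apply/eqP => /(congr1 (fun a : Zp => a 2%N)).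
rewrite residue_natr residue0 modn_small; last first.
  by rewrite -{1}(expn1 p) ltn_exp2l // prime_gt1.
by apply/eqP; rewrite -lt0n prime_gt0.
Qed.

(** Write z = p^k u / (p^m w) with units u and w, and compare k with m. The explicit factor p in the
    second case is what yields |z| >= p, rather than only |z| > 1, for nonintegral z. *)
Lemma padic_int_or_inv z :
  (exists x, z = x%:F) \/ (exists x, z^-1 = (p%:R * x)%:F).
Proof.
have [x [y [y0 ->]]] := padic_fracE z.
have [->|x0] := eqVneq x 0; first by left; exists 0; rewrite tofrac0 mul0r.
have [u Uu ->] := padic_unit_factor x x0.
have [w Uw ->] := padic_unit_factor y y0.
have p0 : p%:R%:F != 0 :> Qp by rewrite tofrac_eq0 padic_p_neq0.
have tofracV (v : Zp) : v \is a GRing.unit -> (v^-1)%:F = (v%:F)^-1 :> Qp.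
  move=> Uv; have v0 : v%:F != 0 :> Qp.
    by rewrite tofrac_eq0; apply: contraTneq Uv => ->; rewrite unitr0.
  by apply: (mulfI v0); rewrite -tofracM divrr // tofrac1 divff.
have cancel_mid (a b c d : Qp) : b != 0 -> a * b * c / (b * d) = a * c / d.
  by move=> b0; rewrite mulrAC (mulrC _ b) -mulf_div divff // mul1r mulrAC.
set k := padic_val x; set m := padic_val y.
have [lemk|ltkm] := leqP m k.
  left; exists (p%:R ^+ (k - m) * u * w^-1).
  rewrite -{1}(subnK lemk) exprD !tofracM !tofracXn tofracV //.
  exact: cancel_mid (expf_neq0 _ p0).
right; exists (p%:R ^+ (m - k.+1) * w * u^-1).
rewrite invf_div -{1}(subnK ltkm) exprD exprS mulrA !tofracM !tofracXn.
rewrite tofracV //.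
rewrite cancel_mid; last exact: expf_neq0.
by rewrite !mulrA (mulrC p%:R%:F).
Qed.

Lemma padic_val_pX k : padic_val (p%:R ^+ k : Zp) = k.
Proof.
rewrite -natrX; apply: padic_val_unique; first by rewrite residue_natr modnn.
rewrite residue_natr modn_small ?ltn_exp2l ?prime_gt1 //.
by apply/eqP; rewrite -lt0n expn_gt0 prime_gt0.
Qed.

End PadicArithmetic.

(** * The p-adic absolute value *)

Section PadicAbsTheory.
Context (R : realType) (p : nat) (p_pr : prime p).
Local Notation Zp := (padic_int p_pr).
Local Notation Qp := (padic p_pr).
Local Notation abs := (@padic_abs R p p_pr).
Implicit Types (x y : Zp) (z w : Qp).

Let p_gt0 : 0 < p%:R :> R.
Proof. by rewrite ltr0n prime_gt0. Qed.

Let p_ge1 : 1 <= p%:R :> R.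
Proof. by rewrite ler1n prime_gt0. Qed.

Lemma padic_abs0 : abs 0 = 0.
Proof. by rewrite /padic_abs eqxx. Qed.

Lemma padic_absM z w : abs (z * w) = abs z * abs w.
Proof.
have [->|z0] := eqVneq z 0; first by rewrite mul0r padic_abs0 mul0r.
have [->|w0] := eqVneq w 0; first by rewrite mulr0 padic_abs0 mulr0.
have [a [b [b0 zE]]] := padic_fracE p p_pr z.
have [c [d [d0 wE]]] := padic_fracE p p_pr w.
have a0 : a != 0 by apply: contraNneq z0 => a0; rewrite zE a0 tofrac0 mul0r.
have c0 : c != 0 by apply: contraNneq w0 => c0; rewrite wE c0 tofrac0 mul0r.
have [ac0 ac] := padic_mul_val a0 c0.
have [bd0 bd] := padic_mul_val b0 d0.
rewrite zE wE mulf_div -!tofracM !padic_abs_frac // ac bd !exprD.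
by rewrite -mulf_div.
Qed.

Lemma padic_abs_int x : abs x%:F <= 1.
Proof.
have [->|x0] := eqVneq x 0; first by rewrite tofrac0 padic_abs0 ler01.
rewrite -[x%:F]divr1 -tofrac1 padic_abs_frac ?oner_neq0 //.
have -> : padic_val (1 : Zp) = 0%N.
  exact: (padic_val_pX p p_pr 0).
by rewrite expr0 div1r invf_le1 ?exprn_gt0 // exprn_ege1.
Qed.

Lemma padic_abs1 : abs 1 = 1.
Proof.
have : abs 1 != 0.
  rewrite /padic_abs oner_eq0 mulf_neq0 ?invr_eq0 // expf_neq0 //;
    exact: lt0r_neq0.
by move=> /mulfI; apply; rewrite -padic_absM !mulr1.
Qed.

Lemma padic_absN1 : abs (-1) = 1.
Proof.
have le1 : abs (-1) <= 1 by rewrite -tofrac1 -tofracN padic_abs_int.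
have ge0 : 0 <= abs (-1).
  rewrite /padic_abs; case: ifP => // _.
  by rewrite divr_ge0 // exprn_ge0 // ltW.
apply/eqP; rewrite -(@pexpr_eq1 _ _ 2) // expr2 -padic_absM mulrNN mulr1.
by rewrite padic_abs1.
Qed.

Lemma padic_abs_gt0 z : z != 0 -> 0 < abs z.
Proof.
by move=> z0; rewrite /padic_abs (negPf z0) divr_gt0 ?exprn_gt0.
Qed.

Lemma padic_absV z : abs z^-1 = (abs z)^-1.
Proof.
have [->|z0] := eqVneq z 0; first by rewrite invr0 padic_abs0 invr0.
have az0 : abs z != 0 by rewrite gt_eqF // padic_abs_gt0.
by apply: (mulfI az0); rewrite -padic_absM !divff // padic_abs1.
Qed.

Lemma padic_abs_pX k : abs (p%:R ^+ k)%:F = (p%:R ^+ k)^-1.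
Proof.
rewrite -[(_ ^+ _)%:F]divr1 -tofrac1.
rewrite padic_abs_frac ?oner_neq0 ?expf_neq0 ?padic_p_neq0 //.
by rewrite padic_val_pX (padic_val_pX p p_pr 0) expr0 div1r.
Qed.

Lemma padic_abs_notint z : ~ (exists x, z = x%:F) -> p%:R <= abs z.
Proof.
case: (padic_int_or_inv p p_pr z) => [//|[x zVE] zNint].
have z0 : z != 0.
  by apply: contra_notN zNint => /eqP->; exists 0; rewrite tofrac0.
rewrite -[z]invrK padic_absV zVE tofracM padic_absM -[p%:R in X in _ <= X]expr1.
rewrite padic_abs_pX expr1 invfM invrK.
rewrite ler_peMr ?(ltW p_gt0) // invf_ge1 ?padic_abs_int //.
rewrite padic_abs_gt0 //; apply: contraNneq z0 => x0.
by rewrite -[z]invrK zVE tofracM x0 mulr0 invr0.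
Qed.

Lemma padic_abs_le1 z : abs z <= 1 -> exists x, z = x%:F.
Proof.
move=> z1; apply: contrapT => /padic_abs_notint pz.
by have := le_trans pz z1; rewrite lern1 leqNgt prime_gt1.
Qed.

End PadicAbsTheory.

(** * Compactness of Z_p and minima over finitely many classes *)

Section PadicCompactness.
Context (p : nat) (p_pr : prime p).
Local Notation Zp := (padic_int p_pr).

(* Koenig's lemma for the tree of residues, which is finitely branching. *)
Lemma padic_compact (I : finType) (P : nat -> (I -> Zp) -> Prop) :
    (forall k a, P k.+1 a -> P k a) -> (forall k, exists a, P k a) ->
  exists a : I -> Zp, forall k, exists2 b, P k b & forall i, b i k = a i k.
Proof.
move=> Pdecr Pne.
have Ple j k a : (j <= k)%N -> P k a -> P j a.
  elim: k => [|k IHk]; first by rewrite leqn0 => /eqP->.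
  rewrite leq_eqVlt => /predU1P[->//|/IHk{}IHk /Pdecr]; exact: IHk.
(* A node [r] at level k is good when every [P j] has a member above it; the limit follows a branch
   of good nodes. *)
pose good k (r : I -> nat) :=
  forall j, exists2 b, P j b & forall i, b i k = r i.
have good0 : good 0%N (fun=> 0%N).
  move=> j; have [b Pb] := Pne j; exists b => // i.
  by rewrite -residue_mod modn1.
have goodS k r : exists r',
    good k r -> good k.+1 r' /\ forall i, (r' i %% p ^ k)%N = r i.
  apply: contrapT => bad.
  have gr : good k r by apply: contrapT => ngr; apply: bad; exists r => /ngr.
  (* If no refinement of [r] were good, each of the finitely many candidates [t] would fail at some
     level [J t]. A member of [P] at the largest of these levels, lying above [r], refutes this. *)
  have /choice[J JP] (t : {ffun I -> 'I_(p ^ k.+1)}) : exists J,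
      (forall i, (t i %% p ^ k)%N = r i) ->
      ~ exists2 b, P J b & forall i, b i k.+1 = t i.
    apply: contrapT => noJ; apply: bad; exists (fun i => t i) => _.
    have tr : forall i, (t i %% p ^ k)%N = r i.
      by apply: contrapT => ntr; apply: noJ; exists 0%N => /ntr.
    split=> // j; apply: contrapT => nb; by apply: noJ; exists j.
  have [b Pb br] := gr (\max_t J t)%N.
  pose t := [ffun i => Ordinal (residue_lt (b i) k.+1)].
  apply: (JP t) => [i|]; first by rewrite ffunE /= residueP br.
  exists b => [|i]; last by rewrite ffunE.
  exact: Ple (leq_bigmax t) Pb.
have /choice[f fP] (kr : nat * (I -> nat)) := goodS kr.1 kr.2.
pose fix r k := if k is k'.+1 then f (k', r k') else fun=> 0%N.
have goodr k : good k (r k).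
  by elim: k => [|k IHk] //=; have [] := fP (k, r k) IHk.
have rP i k : (r k.+1 i %% p ^ k)%N = r k i.
  by have [_ ->] := fP (k, r k) (goodr k).
exists (fun i => PadicInt p_pr (rP i)) => k.
by have [b Pb br] := goodr k k; exists b.
Qed.

End PadicCompactness.

Lemma finite_code_min (R : realType) (A : Type) (T : finType) (code : A -> T)
    (f : A -> R) (P : A -> Prop) :
    (forall x y, P x -> P y -> code x = code y -> f x = f y) ->
    (exists x, P x) ->
  exists2 x, P x & forall y, P y -> f x <= f y.
Proof.
move=> fE [x0 Px0].
have /choice[rep repP] (t : T) : exists y,
    (exists2 x, P x & code x = t) -> P y /\ code y = t.
  have [[x Px xt]|none] := pselect (exists2 x, P x & code x = t).
    by exists x.
  by exists x0 => /none.
pose Q t := `[< exists2 x, P x & code x = t >].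
have Q0 : Q (code x0) by apply/asboolP; exists x0.
case: (arg_minP (fun t => f (rep t)) Q0) => t /asboolP Qt tmin.
have [Pt _] := repP t Qt; exists (rep t) => // y Py.
have Qy : exists2 x, P x & code x = code y by exists y.
have [Pr ry] := repP _ Qy; rewrite -(fE _ _ Pr Py ry).
by apply: tmin; apply/asboolP.
Qed.

(** Level 1 carries the residue modulo p, so some coefficient is a unit and the family is not
    divisible by p. *)
Definition padic_primitive {p : nat} {p_pr : prime p} {m : nat}
  (a : 'I_m -> padic_int p_pr) : Prop := exists i, a i 1%N != 0%N.

(** * Ultrametric norms on integral combinations *)

Section Norm.
Context (R : realType) (p : nat) (p_pr : prime p) (V : vectType (padic p_pr)).
Local Notation Zp := (padic_int p_pr).
Local Notation Qp := (padic p_pr).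
Context (N : V -> R) (normN : is_padic_norm N).

Let p_gt0 : 0 < p%:R :> R.
Proof. by rewrite ltr0n prime_gt0. Qed.

Lemma padic_norm0 : N 0 = 0.
Proof. exact/(padic_norm_eq0 normN). Qed.

Lemma padic_norm_gt0 v : v != 0 -> 0 < N v.
Proof.
move=> v0; rewrite lt_neqAle padic_norm_ge0 // andbT eq_sym.
by apply: contraNneq v0 => /(padic_norm_eq0 normN)->.
Qed.

Lemma padic_normN v : N (- v) = N v.
Proof. by rewrite -scaleN1r padic_normZ // padic_absN1 mul1r. Qed.

Lemma padic_norm_sum_le (I : finType) (P : pred I) (F : I -> V) (C : R) :
  0 <= C -> (forall i, P i -> N (F i) <= C) -> N (\sum_(i | P i) F i) <= C.
Proof.
move=> C0 FC; elim/big_rec: _ => [|i v Pi vC]; first by rewrite padic_norm0.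
by apply: le_trans (padic_normD normN _ _) _; rewrite ge_max FC.
Qed.

Lemma padic_norm_sum_lt (I : finType) (P : pred I) (F : I -> V) (C : R) :
  0 < C -> (forall i, P i -> N (F i) < C) -> N (\sum_(i | P i) F i) < C.
Proof.
move=> C0 FC; elim/big_rec: _ => [|i v Pi vC]; first by rewrite padic_norm0.
by apply: le_lt_trans (padic_normD normN _ _) _; rewrite gt_max FC.
Qed.

(** Isosceles principle: as v = (v + w) - w, a smaller norm of v + w would force N v < N v. *)
Lemma padic_normD_lt v w : N w < N v -> N (v + w) = N v.
Proof.
move=> wv; apply/eqP; rewrite eq_le; apply/andP; split.
  by apply: le_trans (padic_normD normN _ _) _; rewrite ge_max lexx ltW.
rewrite leNgt; apply/negP => vwv.
have := padic_normD normN (v + w) (- w); rewrite addrK padic_normN.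
by rewrite leNgt gt_max vwv wv.
Qed.

Lemma padic_pX_small (C e : R) : 0 <= C -> 0 < e ->
  exists k, C / p%:R ^+ k < e.
Proof.
move=> C0 e0; exists (Num.bound (C / e)).
rewrite ltr_pdivrMr ?exprn_gt0 // -ltr_pdivrMl // mulrC.
apply: lt_trans (archi_boundP _) _; first by rewrite divr_ge0 // ltW.
by rewrite -natrX ltr_nat ltn_expl // prime_gt1.
Qed.

Context (m : nat) (alpha : m.-tuple V).
Local Notation comb a := (\sum_(i < m) (a i)%:F *: alpha`_i).

Lemma padic_norm_comb_congr : exists C : R, 0 <= C /\
  forall k (a b : 'I_m -> Zp), (forall i, a i k = b i k) ->
  N (comb a - comb b) <= C / p%:R ^+ k.
Proof.
exists (\big[Num.max/0]_(i < m) N alpha`_i); split; first exact: bigmax_ge_id.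
move=> k a b ab; rewrite -sumrB; apply: padic_norm_sum_le => [|i _].
  by rewrite divr_ge0 ?exprn_ge0 ?(ltW p_gt0) // bigmax_ge_id.
have /residueB_eq0/residue_eq0P[c abE] := ab i.
rewrite -scalerBl -tofracB abE tofracM padic_normZ // padic_absM padic_abs_pX.
rewrite -mulrA mulrC ler_pM2r ?invr_gt0 ?exprn_gt0 //.
apply: le_trans (le_bigmax _ _ i).
rewrite ler_piMl ?padic_norm_ge0 //; exact: padic_abs_int.
Qed.

Context (free_alpha : free alpha).

(** Otherwise there are primitive combinations of arbitrarily small norm, and compactness produces a
    primitive combination equal to 0, against freeness. *)
Lemma padic_norm_lower_bound : exists k, forall a, padic_primitive a ->
  (p%:R ^+ k)^-1 < N (comb a).
Proof.
have [C [C0 congrC]] := padic_norm_comb_congr.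
apply: contrapT => none.
pose P k a := padic_primitive a /\ N (comb a) <= (p%:R ^+ k)^-1.
have [||a aP] := @padic_compact p p_pr _ P.
- move=> k a [pa Na]; split=> //; apply: le_trans Na _.
  rewrite lef_pV2 ?posrE ?exprn_gt0 // -!natrX ler_nat leq_exp2l //.
  exact: prime_gt1.
- move=> k; apply: contrapT => Pk; apply: none; exists k => a pa.
  by rewrite ltNge; apply/negP => Na; apply: Pk; exists a.
(* Primitivity is visible modulo p, so the limit [a] inherits it from [b]. *)
have [b [[i bi] _] ba] := aP 1%N.
have comb0 : comb a = 0.
  apply/eqP/negPn/negP => /padic_norm_gt0 Na.
  (* The maximum covers both the error C / p^k of approximating [a] by [c] and the bound 1 / p^k on
     the norm at [c]. *)
  have C1_ge0 : 0 <= Num.max C 1 by rewrite le_max C0.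
  have [k] := padic_pX_small (Num.max C 1) (N (comb a)) C1_ge0 Na.
  apply/negP; rewrite -leNgt.
  have [c [_ Nc] ca] := aP k.
  rewrite -[comb a](subrK (comb c)); apply: le_trans (padic_normD normN _ _) _.
  rewrite ge_max; apply/andP; split.
    apply: le_trans (congrC k _ _ _) _ => [j|]; first by rewrite ca.
    by rewrite ler_pM2r ?invr_gt0 ?exprn_gt0 // le_max lexx.
  apply: le_trans Nc _; rewrite -[leLHS]mul1r.
  by rewrite ler_pM2r ?invr_gt0 ?exprn_gt0 // le_max lexx orbT.
have /eqP := freeP free_alpha (fun i => (a i)%:F) comb0 i.
rewrite tofrac_eq0 => /eqP a0.
by move: bi; rewrite ba a0 residue0.
Qed.

(* The norm does not vanish at a primitive vector, hence is locally constant  *)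
(* there, and by compactness the modulus [K] is uniform.                      *)
Lemma padic_norm_locally_constant : exists K,
  forall a b : 'I_m -> Zp, padic_primitive a -> (forall i, a i K = b i K) ->
  N (comb a) = N (comb b).
Proof.
have [C [C0 congrC]] := padic_norm_comb_congr.
have [k kP] := padic_norm_lower_bound.
have [|K KP] := padic_pX_small C (p%:R ^+ k)^-1 C0 _.
  by rewrite invr_gt0 exprn_gt0.
exists K => a b pa ab; rewrite -[comb b](subrK (comb a)) addrC.
rewrite padic_normD_lt //; apply: le_lt_trans (lt_trans KP (kP _ pa)).
by apply: congrC => i; rewrite ab.
Qed.

End Norm.

(** * Changes of basis of a lattice *)

Section Lattices.
Context (p : nat) (p_pr : prime p) (V : vectType (padic p_pr)).
Local Notation Zp := (padic_int p_pr).
Local Notation Qp := (padic p_pr).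
Context (m : nat).
Implicit Types (alpha beta : m.-tuple V) (v w : V).

Lemma lattice_span_nth alpha (i : 'I_m) : lattice_span alpha alpha`_i.
Proof.
exists (fun j => (j == i)%:R); rewrite (bigD1 i) //= eqxx tofrac1 scale1r.
by rewrite big1 ?addr0 // => j /negPf->; rewrite tofrac0 scale0r.
Qed.

Lemma lattice_spanD alpha v w :
  lattice_span alpha v -> lattice_span alpha w -> lattice_span alpha (v + w).
Proof.
move=> [a ->] [b ->]; exists (fun i => a i + b i); rewrite -big_split.
by apply: eq_bigr => i _; rewrite tofracD scalerDl.
Qed.

Lemma lattice_spanZ alpha (c : Zp) v :
  lattice_span alpha v -> lattice_span alpha (c%:F *: v).
Proof.
move=> [a ->]; exists (fun i => c * a i); rewrite scaler_sumr.
by apply: eq_bigr => i _; rewrite tofracM scalerA.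
Qed.

Lemma lattice_spanN alpha v : lattice_span alpha v -> lattice_span alpha (- v).
Proof. by move=> /(lattice_spanZ _ (-1)); rewrite tofracN tofrac1 scaleN1r. Qed.

Lemma lattice_span0 alpha : lattice_span alpha 0.
Proof.
exists (fun=> 0); rewrite big1 // => i _; by rewrite tofrac0 scale0r.
Qed.

Lemma lattice_span_sum alpha (I : finType) (P : pred I) (a : I -> Zp)
    (F : I -> V) :
  (forall i, P i -> lattice_span alpha (F i)) ->
  lattice_span alpha (\sum_(i | P i) (a i)%:F *: F i).
Proof.
move=> FL; elim/big_rec: _ => [|i v Pi vL]; first exact: lattice_span0.
by apply: lattice_spanD => //; apply/lattice_spanZ/FL.
Qed.

Lemma lattice_span_sub alpha beta :
  (forall i : 'I_m, lattice_span alpha beta`_i) ->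
  forall v, lattice_span beta v -> lattice_span alpha v.
Proof. by move=> ab v [a ->]; apply: lattice_span_sum. Qed.

Lemma lattice_span_vspace alpha v : lattice_span alpha v -> v \in <<alpha>>%VS.
Proof.
move=> [a ->]; apply: memv_suml => i _; apply/memvZ/memv_span.
by rewrite mem_nth ?size_tuple.
Qed.

(** Freeness of [beta] is a dimension count: its m vectors span a space containing that of
    [alpha]. *)
Lemma lattice_basisP L alpha beta : lattice_basis L alpha ->
  (forall i : 'I_m, lattice_span alpha beta`_i) ->
  (forall i : 'I_m, lattice_span beta alpha`_i) -> lattice_basis L beta.
Proof.
move=> [free_a ->] ab ba; split; last first.
  by apply/seteqP; split; exact: lattice_span_sub.
rewrite /free eqn_leq dim_span size_tuple /= -{1}(size_tuple alpha).
move: free_a; rewrite /free => /eqP <-; apply: dimvS; apply/span_subvP => v.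
move=> /(nthP 0)[i]; rewrite size_tuple => ltim <-.
exact: lattice_span_vspace (ba (Ordinal ltim)).
Qed.

Lemma lattice_basis_perm L beta (s : 'S_m) : lattice_basis L beta ->
  lattice_basis L [tuple beta`_(s i) | i < m].
Proof.
move=> Lb; apply: (lattice_basisP _ _ _ Lb) => i.
  rewrite nth_mktuple; exact: lattice_span_nth.
have -> : beta`_i = [tuple beta`_(s i) | i < m]`_(s^-1 i)%g.
  by rewrite nth_mktuple permKV.
exact: lattice_span_nth.
Qed.

(** Since the j-th coefficient is 1, the old vector is recovered from the new one by subtracting
    integral multiples of the others. *)
Lemma lattice_basis_replace L beta (y : 'I_m -> Zp) (j : 'I_m) :
  lattice_basis L beta -> y j = 1 ->
  lattice_basis L
    [tuple if i == j then \sum_(k < m) (y k)%:F *: beta`_k else beta`_i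
    | i < m].
Proof.
move=> Lb yj; set gamma := [tuple _ | _ < m].
have gammaE (i : 'I_m) : gamma`_i =
    if i == j then \sum_(k < m) (y k)%:F *: beta`_k else beta`_i.
  by rewrite nth_mktuple.
apply: (lattice_basisP _ _ _ Lb) => i.
  rewrite gammaE; case: ifP => _; last exact: lattice_span_nth.
  by apply: lattice_span_sum => k _; exact: lattice_span_nth.
have [->|ij] := eqVneq i j; last first.
  by have := lattice_span_nth gamma i; rewrite gammaE (negPf ij).
have -> : beta`_j = gamma`_j - \sum_(k < m | k != j) (y k)%:F *: gamma`_k.
  rewrite gammaE eqxx (bigD1 j) //= yj tofrac1 scale1r.
  rewrite [X in _ - X](eq_bigr (fun k : 'I_m => (y k)%:F *: beta`_k)) ?addrK //.
  by move=> k /negPf kj; rewrite gammaE kj.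
apply: lattice_spanD; first exact: lattice_span_nth.
by apply/lattice_spanN/lattice_span_sum => k _; exact: lattice_span_nth.
Qed.

(** If p divided every coefficient, the j-th vector of [beta] would be p times an element of L; its
    j-th coordinate in [beta] would give 1 = p c, impossible modulo p. *)
Lemma lattice_basis_primitive L alpha beta (a : 'I_m -> Zp) (j : 'I_m) :
  lattice_basis L alpha -> lattice_basis L beta ->
  beta`_j = \sum_(i < m) (a i)%:F *: alpha`_i -> padic_primitive a.
Proof.
move=> [_ La] [free_b Lb] bE; apply: contrapT => nprim.
have /choice[b abE] (i : 'I_m) : exists b, a i = p%:R * b.
  have /residue_eq0P[b] : a i 1%N = 0%N.
    by apply/eqP/negPn/negP => ai; apply: nprim; exists i.
  by rewrite expr1 => aE; exists b.
have : lattice_span beta (\sum_(i < m) (b i)%:F *: alpha`_i).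
  by rewrite -Lb La; exists b.
move=> [c cE]; have bjE : beta`_j = \sum_(i < m) (p%:R * c i)%:F *: beta`_i.
  rewrite bE; under eq_bigr do rewrite abE tofracM -scalerA.
  rewrite -scaler_sumr cE scaler_sumr.
  by under eq_bigr do rewrite scalerA -tofracM.
have := congr1 (coord beta j) bjE; rewrite coord_sum_free // coord_free // eqxx.
move=> /eqP; rewrite -tofrac1 tofrac_eq => /eqP /(congr1 (fun x : Zp => x 1%N)).
rewrite residueM residue_natr expn1 modnn mul0n mod0n /= modn_small //.
exact: prime_gt1.
Qed.

End Lattices.

(** * Existence of sorted orthogonal bases *)

Section OrthogonalBases.
Context (R : realType) (p : nat) (p_pr : prime p) (V : vectType (padic p_pr)).
Local Notation Zp := (padic_int p_pr).
Local Notation Qp := (padic p_pr).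
Context (N : V -> R) (normN : is_padic_norm N) (m : nat).
Local Notation abs := (@padic_abs R p p_pr).

(** Bases are given by coefficient matrices with primitive rows, so the sum of norms depends only on
    the matrix modulo p^K and takes finitely many values. *)
Lemma lattice_basis_min (L : set V) : is_lattice m L ->
  exists2 beta : m.-tuple V, lattice_basis L beta &
    forall gamma : m.-tuple V, lattice_basis L gamma ->
      \sum_(i < m) N beta`_i <= \sum_(i < m) N gamma`_i.
Proof.
move=> [alpha La].
have [K KP] := padic_norm_locally_constant R p p_pr V N normN m alpha La.1.
pose mk (a : 'I_m -> 'I_m -> Zp) : m.-tuple V :=
  [tuple \sum_(j < m) (a i j)%:F *: alpha`_j | i < m].
have mkE a (i : 'I_m) : (mk a)`_i = \sum_(j < m) (a i j)%:F *: alpha`_j.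
  by rewrite nth_mktuple.
have mk_onto gamma : lattice_basis L gamma -> exists a, gamma = mk a.
  move=> [_ Lg].
  have /choice[a aE] (i : 'I_m) : lattice_span alpha gamma`_i.
    by rewrite -La.2 Lg; exact: lattice_span_nth.
  by exists a; apply: eq_from_tnth => i; rewrite tnth_mktuple (tnth_nth 0).
pose code (a : 'I_m -> 'I_m -> Zp) : {ffun 'I_m * 'I_m -> 'I_(p ^ K)} :=
  [ffun ij => Ordinal (residue_lt (a ij.1 ij.2) K)].
have [||a Pa amin] := @finite_code_min R _ _ code
    (fun a => \sum_(i < m) N (mk a)`_i) (fun a => lattice_basis L (mk a)).
- move=> a b Pa Pb /ffunP ab; apply: eq_bigr => i _; rewrite !mkE.
  apply: KP; first exact: lattice_basis_primitive La Pa (mkE a i).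
  by move=> j; have := congr1 val (ab (i, j)); rewrite !ffunE.
- by have [a aE] := mk_onto _ La; exists a; rewrite -aE.
exists (mk a) => // gamma Lg; have [b bE] := mk_onto _ Lg.
by rewrite bE; apply: amin; rewrite -bE.
Qed.

(* If N (\sum x_i b_i) is smaller than M = max N (x_i b_i), keep only the     *)
(* terms of norm M and divide by the coefficient x_j of largest absolute      *)
(* value: the result can replace b_j in the basis and has a smaller norm.     *)
Lemma orthogonal_basis_exists (L : set V) : is_lattice m L ->
  exists beta : m.-tuple V, orthogonal_basis N L beta.
Proof.
move=> /lattice_basis_min[beta Lb bmin]; exists beta; split=> // x.
set M := \big[Num.max/0]_(i < m) _.
have xM i : N (x i *: beta`_i) <= M by exact: le_bigmax.
have M_ge0 : 0 <= M by exact: bigmax_ge_id.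
have sum_le : N (\sum_(i < m) x i *: beta`_i) <= M by apply: padic_norm_sum_le.
apply/eqP; rewrite eq_le sum_le /= leNgt; apply/negP => sumM.
have M_gt0 : 0 < M by apply: le_lt_trans sumM; exact: padic_norm_ge0.
pose S := [pred i | N (x i *: beta`_i) == M].
have [j0 Sj0] : exists j, S j.
  apply: contrapT => S0; suff : M < M by rewrite ltxx.
  apply: bigmax_lt => // i _; rewrite lt_neqAle xM andbT.
  by apply/negP => Si; apply: S0; exists i.
case: (arg_maxP (fun i => abs (x i)) Sj0) => j Sj jmax.
have xj0 : x j != 0.
  apply: contraTneq Sj => xj0; rewrite /= xj0 scale0r.
  by rewrite (padic_norm0 _ _ _ _ _ normN) lt_eqF.
have axj_gt0 := padic_abs_gt0 R p p_pr _ xj0.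
have /choice[y yE] (i : 'I_m) : exists y : Zp,
    (if S i then x i / x j else 0) = y%:F.
  case: ifP => Si; last by exists 0; rewrite tofrac0.
  apply: (padic_abs_le1 R); rewrite padic_absM padic_absV.
  by rewrite ler_pdivrMr // mul1r; exact: jmax.
have yj : y j = 1.
  by apply/eqP; rewrite -tofrac_eq -yE Sj divff // tofrac1.
have sumyE : \sum_(k < m) (y k)%:F *: beta`_k =
    (x j)^-1 *: \sum_(k < m | S k) x k *: beta`_k.
  rewrite scaler_sumr [RHS]big_mkcond; apply: eq_bigr => k _; rewrite -yE.
  by case: ifP => _; rewrite ?scale0r // scalerA mulrC.
(* The kept part is the full sum minus the discarded terms, and both have norm below M. *)
have sumS_lt : N (\sum_(k < m | S k) x k *: beta`_k) < M.
  have -> : \sum_(k < m | S k) x k *: beta`_k =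
      \sum_(k < m) x k *: beta`_k - \sum_(k < m | ~~ S k) x k *: beta`_k.
    by rewrite [X in X - _](bigID S) addrK.
  apply: le_lt_trans (padic_normD normN _ _) _; rewrite gt_max sumM.
  rewrite (padic_normN _ _ _ _ _ normN).
  by apply: padic_norm_sum_lt => // k Sk; rewrite lt_neqAle Sk xM.
have sumy_lt : N (\sum_(k < m) (y k)%:F *: beta`_k) < N beta`_j.
  rewrite sumyE padic_normZ // padic_absV mulrC ltr_pdivrMr // mulrC.
  by rewrite -padic_normZ // (eqP Sj).
have := bmin _ (lattice_basis_replace _ _ _ _ _ _ y j Lb yj).
rewrite leNgt => /negP; apply.
rewrite (bigD1 j) //= [X in _ < X](bigD1 j) //=.
rewrite nth_mktuple eqxx ltr_leD // le_eqVlt; apply/orP; left; apply/eqP.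
by apply: eq_bigr => k /negPf kj; rewrite nth_mktuple kj.
Qed.

Lemma orthogonal_basis_perm (L : set V) (beta : m.-tuple V) (s : 'S_m) :
  orthogonal_basis N L beta ->
  orthogonal_basis N L [tuple beta`_(s i) | i < m].
Proof.
move=> [Lb orth]; split=> [|x]; first exact: lattice_basis_perm.
have xE i : x i *: [tuple beta`_(s i) | i < m]`_i =
    x ((s^-1)%g (s i)) *: beta`_(s i).
  by rewrite nth_mktuple permK.
rewrite (eq_bigr _ (fun i _ => xE i)).
rewrite [RHS](eq_bigr _ (fun i _ => congr1 N (xE i))).
have := orth (fun i => x ((s^-1)%g i)).
rewrite (reindex_inj (@perm_inj _ s)).
by rewrite [X in _ = X](reindex_inj (@perm_inj _ s)).
Qed.

Lemma sorted_orthogonal_basis_exists (L : set V) : is_lattice m L ->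
  exists beta : m.-tuple V,
    orthogonal_basis N L beta /\ nonincreasing_norm N beta.
Proof.
move=> /orthogonal_basis_exists[beta ob].
pose r : rel V := fun v w => N w <= N v.
have r_total : total r by move=> v w; rewrite /r le_total.
have r_trans : transitive r by move=> v u w uv vw; exact: le_trans vw uv.
have /tuple_permP[s sE] : perm_eq (sort r beta) beta by rewrite perm_sort.
have tE (i : 'I_m) : tnth beta (s i) = beta`_(s i) by rewrite (tnth_nth 0).
exists [tuple beta`_(s i) | i < m]; split; first exact: orthogonal_basis_perm.
have eqs : sort r beta = [tuple beta`_(s i) | i < m].
  by rewrite sE; congr val; apply: eq_mktuple.
move=> i j ij; rewrite -eqs.
apply: (sorted_leq_nth r_trans _ 0 (sort_sorted r_total beta)) => //.
- by move=> v; rewrite /r lexx.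
- by rewrite inE size_sort size_tuple.
- by rewrite inE size_sort size_tuple.
Qed.

End OrthogonalBases.

(** * The escape distance computed in an orthogonal basis *)

Lemma min_of_eq (R : realType) (A : set R) (r : R) : A r -> lbound A r -> min_of A = r.
Proof.
move=> Ar lbr; rewrite /min_of.
case: xgetP => [s _ [As lbs]|/(_ r)]; last by case.
by apply/eqP; rewrite eq_le lbr // lbs.
Qed.

Section EscapeDistance.
Context (R : realType) (p : nat) (p_pr : prime p) (V : vectType (padic p_pr)).
Local Notation Zp := (padic_int p_pr).
Local Notation Qp := (padic p_pr).
Context (N : V -> R) (normN : is_padic_norm N) (n : nat) (dimV : \dim {:V} = n).
Context (L : set V) (beta : n.-tuple V) (ob : orthogonal_basis N L beta).
Local Notation abs := (@padic_abs R p p_pr).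

Lemma padic_decomposition (v : V) :
  exists x : 'I_n -> Qp, v = \sum_(i < n) x i *: beta`_i.
Proof.
have [[free_b _] _] := ob; exists (fun i => coord beta i v).
apply: coord_span; suff -> : <<beta>>%VS = fullv by exact: memvf.
apply/eqP; rewrite eqEdim subvf /= dimV; move: free_b.
by rewrite /free size_tuple => /eqP->.
Qed.

Lemma le_norm_coord (x : 'I_n -> Qp) i :
  abs (x i) * N beta`_i <= N (\sum_(k < n) x k *: beta`_k).
Proof.
rewrite ob.2 -padic_normZ //.
exact: (le_bigmax _ (fun k : 'I_n => N (x k *: beta`_k))).
Qed.

(** A nearest point keeps the integral coordinates of v and sets the others to 0: subtracting a
    p-adic integer cannot shrink a nonintegral coordinate. *)
Lemma dist_attained (v : V) : exists2 w, L w & dist N L v = N (v - w).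
Proof.
have [x ->] := padic_decomposition v.
have /choice[a aE] (i : 'I_n) : exists a : Zp,
    x i = a%:F \/ a = 0 /\ ~ (exists b : Zp, x i = b%:F).
  have [[a aE]|nint] := pselect (exists a : Zp, x i = a%:F).
    by exists a; left.
  by exists 0; right.
pose w := \sum_(i < n) (a i)%:F *: beta`_i.
have Lw : L w by rewrite ob.1.2; exists a.
exists w => //; apply: min_of_eq; first by exists w.
move=> _ [w' + <-]; rewrite {1}ob.1.2 => -[b ->].
rewrite -!sumrB; under eq_bigr do rewrite -scalerBl.
under [X in _ <= N X]eq_bigr do rewrite -scalerBl.
apply: (padic_norm_sum_le _ _ _ _ _ normN) => [|i _].
  exact: padic_norm_ge0.
have [->|[-> nint]] := aE i.
  by rewrite subrr scale0r (padic_norm0 _ _ _ _ _ normN) padic_norm_ge0.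
apply: le_trans (le_norm_coord (fun k => x k - (b k)%:F) i).
rewrite tofrac0 subr0 padic_normZ //.
(* Either |x_i| <= |x_i - b_i|, as wanted, or |x_i| <= |b_i| <= 1 < |x_i| unless the basis vector
   has norm 0; all terms carry the factor N of that vector. *)
have := padic_normD normN ((x i - (b i)%:F) *: beta`_i) ((b i)%:F *: beta`_i).
rewrite -scalerDl subrK !padic_normZ // le_max => /orP[//|le_xb].
have xgt1 : 1 < abs (x i).
  apply: lt_le_trans (padic_abs_notint R _ _ _ nint).
  by rewrite ltr1n prime_gt1.
have [->|Nb0] := eqVneq (N beta`_i) 0; first by rewrite !mulr0.
have Nb_gt0 : 0 < N beta`_i by rewrite lt_neqAle eq_sym Nb0 padic_norm_ge0.
move: le_xb; rewrite ler_pM2r // leNgt (le_lt_trans _ xgt1) //.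
exact: padic_abs_int.
Qed.

Lemma norm_notin_ge (n_gt0 : (0 < n)%N) (nib : nonincreasing_norm N beta)
    (v : V) :
  ~ L v -> p%:R * N beta`_n.-1 <= N v.
Proof.
have [x ->] := padic_decomposition v; move=> nLv.
have [i nint] : exists i, ~ exists a : Zp, x i = a%:F.
  apply: contrapT => allint; apply: nLv; rewrite ob.1.2.
  have /choice[a aE] (i : 'I_n) : exists a : Zp, x i = a%:F.
    by apply: contrapT => ni; apply: allint; exists i.
  by exists a; apply: eq_bigr => i _; rewrite aE.
apply: le_trans (le_norm_coord x i).
have ltn1 : (n.-1 < n)%N by rewrite prednK.
apply: ler_pM; rewrite ?ler0n ?padic_norm_ge0 ?padic_abs_notint //.
by apply: (nib i (Ordinal ltn1)); rewrite /= -ltnS prednK.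
Qed.

Lemma escape_distance_orthogonal (n_gt0 : (0 < n)%N)
    (nib : nonincreasing_norm N beta) :
  escape_distance N L = p%:R * N beta`_n.-1.
Proof.
have ltn1 : (n.-1 < n)%N by rewrite prednK.
pose j := Ordinal ltn1; have [[free_b Lb] orth] := ob.
have sub_nin v w : ~ L v -> L w -> ~ L (v - w).
  rewrite Lb => nLv Lw Lvw; apply: nLv; rewrite -[v](subrK w).
  exact: lattice_spanD.
have abspV : abs (p%:R^-1) = p%:R.
  have := padic_abs_pX R p p_pr 1; rewrite !expr1 rmorph_nat => absp.
  by rewrite padic_absV absp invrK.
apply: min_of_eq.
  have pb_nin : ~ L (p%:R^-1 *: beta`_j).
    rewrite Lb => -[a /(congr1 (coord beta j))].
    rewrite linearZ /= -[n.-1]/(val j).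
    rewrite coord_free // eqxx coord_sum_free // => aE.
    have := padic_abs_int R p p_pr (a j); rewrite -aE mulr1 abspV.
    by rewrite lern1 leqNgt prime_gt1.
  (* The distance from b_n / p is attained at 0, since every translate of it by L is still outside
     L. *)
  exists (p%:R^-1 *: beta`_j) => //; apply: min_of_eq.
    exists 0; first by rewrite Lb; exact: lattice_span0.
    by rewrite subr0 padic_normZ // abspV.
  by move=> _ [w Lw <-]; apply: norm_notin_ge => //; exact: sub_nin.
(* As [min_of] returns 0 when there is no minimum, the lower bound on the distance relies on an
   actual nearest point [w]. *)
move=> _ [v nLv <-]; have [w Lw ->] := dist_attained v.
by apply: norm_notin_ge => //; exact: sub_nin.
Qed.
End EscapeDistance.

Theorem theorem4p7 (R : realType) (p : nat) (p_pr : prime p)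
    (V : vectType (padic p_pr)) (n : nat) (n_gt0 : (0 < n)%N)
    (dimV : \dim {:V} = n) (N : V -> R) (normN : is_padic_norm N)
    (L : set V) (latL : is_lattice n L) :
  escape_distance N L = p%:R * successive_max N n L n.
Proof.
(* [xget] selects the value of some sorted orthogonal basis, to which the formula applies; existence
   of such a basis excludes the default 0. *)
rewrite /successive_max; case: xgetP => [r _ [beta [ob nib ->]]|none].
  exact: escape_distance_orthogonal.
have [beta [ob nib]] :=
  sorted_orthogonal_basis_exists R p p_pr V N normN n L latL.
by case: (none (N beta`_n.-1)); exists beta.
Qed.
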